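(* There is a constant $c>0$ such that for every sufficiently large $n$ that is a perfect square, every deterministic $\mathsf{Online}$-$\mathsf{LOCAL}$ algorithm that properly 3-colors every $(\sqrt{n}\times\sqrt{n})$ simple grid (for every identifier assignment and every processing order chosen by the adversary) has locality $T(n)\ge c\log n$. In other words, the locality of 3-coloring $(\sqrt{n}\times\sqrt{n})$ simple grids in the $\mathsf{Online}$-$\mathsf{LOCAL}$ model is $\Omega(\log n)$.
   Context: For a graph $G=(V,E)$, $U\subseteq V$ and an integer $T\ge 0$, $\mathcal{B}(U,T)$ denotes the set of nodes at distance at most $T$ from some node of $U$, and $G[U]$ denotes the induced subgraph. The $\mathsf{Online}$-$\mathsf{LOCAL}$ model: an algorithm with locality $T=T(n)$ is deterministic and knows $n$. The adversary chooses an $n$-node input graph $G=(V,E)$ from the input family, assigns distinct identifiers from $\{1,\dots,\mathrm{poly}(n)\}$ to its nodes, and chooses an ordering $\sigma=(v_1,\dots,v_n)$ of $V$. For $i=1,\dots,n$, when $v_i$ is presented, the algorithm must irrevocably assign an output (here a color) to $v_i$ as a function of the sequence $(v_1,\dots,v_i)$ and the induced subgraph $G_i=G\big[\bigcup_{j\le i}\mathcal{B}(v_j,T)\big]$ (with identifiers); thus the algorithm has global memory of everything seen so far. The algorithm solves a coloring problem on an input family if for every choice of the adversary the final coloring is proper and uses only the allowed colors. The locality of a problem is the minimum locality of an algorithm solving it. An $(a\times b)$ simple grid has node set $\{(i,j): i\in[a], j\in[b]\}$, with $(i,j)$ and $(i',j')$ adjacent iff $|i-i'|+|j-j'|=1$.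 *)

(* Defs.v *)
From mathcomp Require Import all_boot.
From Stdlib Require Import Reals.

Set Implicit Arguments.
Unset Strict Implicit.
Unset Printing Implicit Defensive.

Definition gnode (m : nat) : finType := ('I_m * 'I_m)%type.

(* (i,j) ~ (i',j') iff |i-i'| + |j-j'| = 1  (truncated subtractions give |.|). *)
Definition grid_adj (m : nat) : rel (gnode m) :=
  fun x y =>
    ((x.1 : nat) - y.1) + ((y.1 : nat) - x.1)
    + (((x.2 : nat) - y.2) + ((y.2 : nat) - x.2)) == 1.

Fixpoint within (V : finType) (e : rel V) (k : nat) (x y : V) : bool :=
  match k with
  | 0 => x == y
  | k'.+1 => within e k' x y || [exists z, within e k' x z && e z y]
  end.

Definition in_ball (V : finType) (e : rel V) (U : seq V) (T : nat) (y : V) : bool :=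
  has (fun x => within e T x y) U.

(* A deterministic Online-LOCAL algorithm (for a fixed, known n and a fixed
   locality T).  When v_i is presented it sees, with nodes named by their
   (distinct) identifiers:
   - the sequence of identifiers of v_1, ..., v_i,
   - the node set of G_i = G[ B({v_1..v_i}, T) ] (as a predicate on ids),
   - the edge relation of G_i (as a relation on ids),
   and outputs a color in {0,1,2}. *)
Definition online_alg : Type :=
  seq nat -> (nat -> bool) -> (nat -> nat -> bool) -> 'I_3.

Definition online_coloring (m T : nat) (A : online_alg)
    (id : gnode m -> nat) (s : seq (gnode m)) (v : gnode m) : 'I_3 :=
  let p := take (index v s).+1 s in
  let W := in_ball (@grid_adj m) p T in
  A (map id p)
    (fun a => [exists u, W u && (id u == a)])
    (fun a b => [exists u, [exists w,
        [&& W u, W w, id u == a, id w == b & grid_adj u w]]]).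

Definition valid_ids (m idmax : nat) (id : gnode m -> nat) : Prop :=
  injective id /\ forall v, 1 <= id v <= idmax.

Definition valid_order (m : nat) (s : seq (gnode m)) : Prop :=
  perm_eq s (enum (gnode m)).

Definition proper_3col (m : nat) (col : gnode m -> 'I_3) : Prop :=
  forall u v, grid_adj u v -> col u != col v.

Definition solves_grid_3col (m idmax T : nat) (A : online_alg) : Prop :=
  forall (id : gnode m -> nat) (s : seq (gnode m)),
    valid_ids idmax id -> valid_order s ->
    proper_3col (online_coloring T A id s).

(* Main.v *)
Require Import Defs.
From mathcomp Require Import all_boot zify boolp.
From Stdlib Require Import Reals Lra Lia.

(** Steps of a proper 3-coloring, read as +1 or -1 modulo 3, sum to 0 around
    every 4-cycle, so they define a height function on the grid; along a row its
    increments over a distance d have the parity of d.  The adversary reveals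
    row segments whose relative position is still undetermined.  Given two
    segments that each rise by k, oriented alike by a reflection and joined with
    a gap of the right parity, some span of the union changes by at least k + 1.
    After 4T + 5 doublings a span of length 2^O(T) rises by 4T + 5; a parallel
    segment of the same length, 2T + 2 rows away and reflected so as not to rise,
    contradicts the fact that the two rises differ by at most 2(2T + 2).  All of
    this fits in the grid unless T is of order log n. *)

Set Implicit Arguments.
Unset Strict Implicit.
Unset Printing Implicit Defensive.

(** * Heights along a row *)

(** The representative of [b - a] modulo 3 in {-1, 0, 1}; the value 0 occurs only for equal
    colors. *)
Definition color_step (a b : 'I_3) : Z :=
  if b == a.+1 %% 3 :> nat then 1%Z
  else if a == b.+1 %% 3 :> nat then (-1)%Z else 0%Z.

Fixpoint height (c : nat -> 'I_3) (n : nat) : Z :=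
  if n is n'.+1 then (height c n' + color_step (c n') (c n'.+1))%Z else 0%Z.

Definition proper_upto (c : nat -> 'I_3) (n : nat) : Prop :=
  forall x, x.+1 < n -> c x != c x.+1.

Lemma color_step_opp (a b : 'I_3) : color_step b a = (- color_step a b)%Z.
Proof. by case: a => [[|[|[|a]]] Ha] //; case: b => [[|[|[|b]]] Hb]. Qed.

Lemma color_step_odd (a b : 'I_3) :
  a != b -> exists k : Z, color_step a b = (1 + 2 * k)%Z.
Proof.
by case: a => [[|[|[|a]]] Ha] //; case: b => [[|[|[|b]]] Hb] //= _;
  ((by exists 0%Z) || (by exists (-1)%Z)).
Qed.

Lemma color_step_bound (a b : 'I_3) : (-1 <= color_step a b <= 1)%Z.
Proof. by rewrite /color_step; case: ifP => _; [|case: ifP => _]; lia. Qed.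

(* Both sides are even, at most 2 in absolute value, and congruent mod 3. *)
Lemma color_step_square (a b c d : 'I_3) :
  a != b -> b != c -> a != d -> d != c ->
  (color_step a b + color_step b c = color_step a d + color_step d c)%Z.
Proof.
by case: a => [[|[|[|a]]] Ha] //; case: b => [[|[|[|b]]] Hb] // _;
   case: c => [[|[|[|c]]] Hc] // _; case: d => [[|[|[|d]]] Hd].
Qed.

Lemma heightS (c : nat -> 'I_3) n :
  height c n.+1 = (height c n + color_step (c n) (c n.+1))%Z.
Proof. by []. Qed.

Lemma eq_height (c c' : nat -> 'I_3) n :
  (forall x, x <= n -> c x = c' x) -> height c n = height c' n.
Proof.
elim: n => [//|n IH] E /=.
by rewrite IH ?(E n) ?(E n.+1) // => x Hx; apply: E; lia.
Qed.

Lemma height_shift (c : nat -> 'I_3) o n :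
  height (fun x => c (o + x)%nat) n = (height c (o + n)%nat - height c o)%Z.
Proof.
elim: n => [|n IH]; first by rewrite addn0 /=; lia.
by rewrite addnS !heightS IH addnS; lia.
Qed.

Lemma height_rev (c : nat -> 'I_3) r n : n <= r ->
  height (fun x => c (r - x)%nat) n = (height c (r - n)%nat - height c r)%Z.
Proof.
elim: n => [|n IH] Hn; first by rewrite subn0 /=; lia.
rewrite heightS IH; last by lia.
have -> : r - n = (r - n.+1).+1 by lia.
by rewrite heightS (color_step_opp (c (r - n.+1)) (c (r - n.+1).+1)); lia.
Qed.

Lemma height_parity (c : nat -> 'I_3) l n :
  proper_upto c l -> n < l -> exists k, height c n = (Z.of_nat n + 2 * k)%Z.
Proof.
move=> P; elim: n => [|n IH] Hn; first by exists 0%Z.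
have [k E] := IH (ltnW Hn); have [k' E'] := color_step_odd (P _ Hn).
by exists (k + k')%Z; rewrite heightS E E'; lia.
Qed.

(** Summing the square identity along two adjacent rows leaves only the vertical steps at both ends,
    each at most 1 in absolute value. Each further row thus costs at most 2. *)
Lemma grid_height_gap (c : nat -> nat -> 'I_3) m n y D x :
  (forall x y, x.+1 < m -> y < n -> c x y != c x.+1 y) ->
  (forall x y, x < m -> y.+1 < n -> c x y != c x y.+1) ->
  x < m -> y + D < n ->
  (Z.abs (height (c^~ (y + D)%nat) x - height (c^~ y) x) <= 2 * Z.of_nat D)%Z.
Proof.
move=> Hh Hv Hx; elim: D => [|D IH] HD; first by rewrite addn0; lia.
suff E : (height (c^~ (y + D.+1)%nat) x - height (c^~ (y + D)%nat) x =
   color_step (c x (y + D)%nat) (c x (y + D).+1%nat)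
   - color_step (c 0%nat (y + D)%nat) (c 0%nat (y + D).+1%nat))%Z.
  have := IH ltac:(lia).
  by have := color_step_bound (c x (y + D)%nat) (c x (y + D).+1%nat);
     have := color_step_bound (c 0%nat (y + D)%nat) (c 0%nat (y + D).+1%nat); lia.
elim: x Hx {IH} => [|x IHx] Hx; first by rewrite addnS /=; lia.
have := IHx ltac:(lia).
rewrite !heightS !addnS.
have := @color_step_square (c x (y + D)%nat) (c x.+1 (y + D)) (c x.+1 (y + D).+1%nat)
  (c x (y + D).+1%nat).
by rewrite Hh ?Hv ?Hh; lia.
Qed.

(* If both pieces rise by exactly k, then a gap of height g makes one of the
   three spans exceed k in absolute value unless g = -k, which parity excludes. *)
Lemma merge_heights (c : nat -> 'I_3) l k i1 j1 i2 j2 :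
  proper_upto c l -> i1 <= j1 -> j1 < i2 -> i2 <= j2 -> j2 < l ->
  odd (i2 - j1 + k) ->
  (Z.of_nat k <= height c j1 - height c i1)%Z ->
  (Z.of_nat k <= height c j2 - height c i2)%Z ->
  exists i j, [/\ i < l, j < l & (Z.of_nat k.+1 <= height c j - height c i)%Z].
Proof.
move=> P H1 H12 H2 Hl Hodd V1 V2.
have [a Ea] := @height_parity c l j1 P ltac:(lia).
have [b Eb] := @height_parity c l i2 P ltac:(lia).
have G : (height c i2 - height c j1 <> - Z.of_nat k)%Z.
  rewrite Ea Eb => E; have := odd_double_half (i2 - j1 + k).
  by rewrite Hodd -muln2; lia.
set g := (height c i2 - height c j1)%Z in G.
(* The span is chosen by the size of [g]: above [k] the gap alone, from 1 on the first piece with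
   the gap, below [-k] the gap read backwards, and for [-k < g <= 0] everything from [i1] to
   [j2]. *)
case: (Z.le_gt_cases (Z.of_nat k.+1) g) => [L|L]; first by exists j1, i2; split; lia.
case: (Z.le_gt_cases 1 g) => [L1|L1]; first by exists i1, i2; split; lia.
case: (Z.le_gt_cases g (- Z.of_nat k.+1)) => [L2|L2].
  by exists i2, j1; split; lia.
exists i1, j2; split; lia.
Qed.

(** * Views of partially revealed fragments *)

(** Views are stated through identifiers alone, so they do not tell where a fragment lies in the
    grid. With [Prop]-valued predicates, equivalent views become equal by extensionality. *)
Record scene := Scene {
  scene_order : seq nat;
  scene_nodes : nat -> Prop;
  scene_edges : nat -> nat -> Prop }.

Definition scene0 := Scene [::] (fun _ => False) (fun _ _ => False).

Definition dist1 (u v u' v' : nat) := (u - u') + (u' - u) + ((v - v') + (v' - v)).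

(* Segment node [x] sits at [(x + T, T)], so that the radius-[T] ball of a
   segment of length [l] lies in the rectangle [0, l + 2T) x [0, 2T]. *)
Definition near (T : nat) (q : seq nat) (u v : nat) : Prop :=
  exists2 x, x \in q & dist1 (x + T) T u v <= T.

(** [F] names the cells of the rectangle around the segment, and [q] is the order in which positions
    are presented. New edges join cells of this fragment only, so its place relative to older ones
    stays open. *)
Definition add_fragment (T : nat) (S : scene) (F : nat -> nat -> nat) (q : seq nat) :=
  Scene (scene_order S ++ [seq F (x + T) T | x <- q])
    (fun a => scene_nodes S a \/ exists u v, near T q u v /\ F u v = a)
    (fun a b => scene_edges S a b \/
       exists u v u' v', [/\ near T q u v, near T q u' v', F u v = a, F u' v' = b
                           & dist1 u v u' v' = 1]).

Definition answer (A : online_alg) (S : scene) : 'I_3 :=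
  A (scene_order S) (fun a => `[< scene_nodes S a >])
    (fun a b => `[< scene_edges S a b >]).

(** The scene stops at [x] in [q], so positions presented later cannot affect this color. *)
Definition fragment_color (T : nat) (A : online_alg) S F q (x : nat) : 'I_3 :=
  answer A (add_fragment T S F (take (index x q).+1 q)).

(** Reflection of the columns 0 to [r + 2 * T]; it exchanges the segment positions [x] and
    [r - x]. *)
Definition flip_fragment (T r : nat) (F : nat -> nat -> nat) : nat -> nat -> nat :=
  fun u v => F (r + 2 * T - u) v.

(** The columns strictly between the two rectangles are named column by column with new identifiers
    from [B] on. *)
Definition merge_fragments (T l g B : nat) (F1 F2 : nat -> nat -> nat) :=
  fun u v => if u < l + 2 * T then F1 u v
             else if u < l + g then B + (u - (l + 2 * T)) * (2 * T).+1 + v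
             else F2 (u - (l + g)) v.

Lemma scene_eq S S' : scene_order S = scene_order S' ->
  (forall a, scene_nodes S a <-> scene_nodes S' a) ->
  (forall a b, scene_edges S a b <-> scene_edges S' a b) -> S = S'.
Proof.
case: S S' => [p W E] [p' W' E'] /= -> HW HE.
by congr Scene; [apply: funext => a | apply: funext => a; apply: funext => b];
   apply: propext.
Qed.

Lemma take_index_catl (I : eqType) (x : I) (s1 s2 : seq I) : x \in s1 ->
  take (index x (s1 ++ s2)).+1 (s1 ++ s2) = take (index x s1).+1 s1.
Proof.
move=> Hx; rewrite index_cat Hx takel_cat //.
by rewrite index_mem.
Qed.

Lemma take_index_catr (I : eqType) (x : I) (s1 s2 : seq I) : x \notin s1 ->
  take (index x (s1 ++ s2)).+1 (s1 ++ s2) = s1 ++ take (index x s2).+1 s2.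
Proof.
move=> Hx; rewrite index_cat (negbTE Hx) take_cat.
by case: ltnP => [|_]; [lia | congr (_ ++ take _ _); lia].
Qed.

Lemma take_index_map (I J : eqType) (f : I -> J) (x : I) (s : seq I) :
  {in s &, injective f} -> x \in s ->
  take (index (f x) (map f s)).+1 (map f s) = map f (take (index x s).+1 s).
Proof.
move=> inj Hx; rewrite map_take; congr (take _.+1 _).
elim: s inj Hx => [//|y s IH] inj /=.
rewrite inE; case: (eqVneq y x) => [->|Nyx] /= Hx; first by rewrite eqxx.
case: eqP => [E|_].
  by have := inj y x (mem_head _ _) _ E; rewrite inE Hx orbT => /(_ isT) /eqP;
     rewrite (negbTE Nyx).
by rewrite IH // => a b Ha Hb; apply: inj; rewrite inE ?Ha ?Hb orbT.
Qed.

Lemma add_fragment_nil T S F : add_fragment T S F [::] = S.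
Proof.
apply: scene_eq => [|a|a b]; first by rewrite /= cats0.
- by split=> [[//|[u [v [[x]]]]]|]; [|left].
- by split=> [[//|[u [v [u' [v' [[x]]]]]]]|]; [|left].
Qed.

Lemma near_bound T q l u v : (forall x, x \in q -> x < l) -> near T q u v ->
  u < l + 2 * T /\ v <= 2 * T.
Proof. by move=> Hq [x /Hq Hx]; rewrite /dist1; lia. Qed.

Lemma near_cat T q1 q2 u v : near T (q1 ++ q2) u v <-> near T q1 u v \/ near T q2 u v.
Proof.
split=> [[x]|[[x Hx D]|[x Hx D]]].
- by rewrite mem_cat => /orP[] Hx D; [left|right]; exists x.
- by exists x; rewrite // mem_cat Hx.
- by exists x; rewrite // mem_cat Hx orbT.
Qed.

Lemma near_shift T q o u v :
  near T (map (addn o) q) u v <-> o <= u /\ near T q (u - o) v.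
Proof.
split=> [[x /mapP[y Hy ->]]|[Ho [x Hx]]]; rewrite /dist1 => D.
  by split; [lia | exists y; rewrite // /dist1; lia].
by exists (o + x); [rewrite map_f | rewrite /dist1; lia].
Qed.

Lemma near_rev T q r u v : (forall x, x \in q -> x <= r) ->
  near T (map (subn r) q) u v <-> u <= r + 2 * T /\ near T q (r + 2 * T - u) v.
Proof.
move=> Hq; split=> [[x /mapP[y Hy ->]]|[Ho [x Hx]]]; rewrite /dist1 => D.
  by have := Hq _ Hy => Hr; split; [lia | exists y; rewrite // /dist1; lia].
by have := Hq _ Hx => Hr; exists (r - x); [rewrite map_f | rewrite /dist1; lia].
Qed.

(** Reflection preserves distances, and the algorithm sees only identifiers. Hence the orientation
    of a fragment can be fixed after its colors are known. *)
Lemma add_flip_fragment T S F q r : (forall x, x \in q -> x <= r) ->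
  add_fragment T S (flip_fragment T r F) (map (subn r) q) = add_fragment T S F q.
Proof.
move=> Hq; have R u v := near_rev T u v Hq.
have N u v : near T q u v -> u <= r + 2 * T.
  by move/(near_bound (l := r.+1)); case=> [x /Hq|]; lia.
rewrite /flip_fragment; apply: scene_eq => [|a|a b] /=.
- congr (_ ++ _); rewrite -map_comp; apply/eq_in_map => x /Hq Hx /=.
  by congr (F _ _); lia.
- split=> [[|[u [v [/R[Hu N1] <-]]]]|[|[u [v [N1 <-]]]]]; try by left.
    by right; exists (r + 2 * T - u), v.
  right; exists (r + 2 * T - u), v; have Hu := N _ _ N1.
  have E : r + 2 * T - (r + 2 * T - u) = u by lia.
  by rewrite E; split=> //; apply/R; rewrite E; split=> //; lia.
- split=> [[|[u [v [u' [v' [/R[Hu N1] /R[Hu' N2] <- <- D]]]]]]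
    |[|[u [v [u' [v' [N1 N2 <- <- D]]]]]]]; try by left.
    right; exists (r + 2 * T - u), v, (r + 2 * T - u'), v'; split=> //.
    by move: D; rewrite /dist1; lia.
  right; exists (r + 2 * T - u), v, (r + 2 * T - u'), v'.
  have Hu := N _ _ N1; have Hu' := N _ _ N2.
  have E : r + 2 * T - (r + 2 * T - u) = u by lia.
  have E' : r + 2 * T - (r + 2 * T - u') = u' by lia.
  rewrite E E'; split=> //; try (apply/R; rewrite ?E ?E'; split=> //; lia).
  by move: D; rewrite /dist1; lia.
Qed.

(** For [2 * T < g] at least one column separates the two views, so no edge joins them and showing
    the fragments separately gives the same scene. *)
Lemma add_merge_fragments T S l g B F1 F2 q1 q2 :
  (forall x, x \in q1 -> x < l) -> 2 * T < g ->
  add_fragment T S (merge_fragments T l g B F1 F2) (q1 ++ map (addn (l + g)) q2)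
  = add_fragment T (add_fragment T S F1 q1) F2 q2.
Proof.
move=> Hq Hg; set F := merge_fragments _ _ _ _ _ _.
have FL u v : u < l + 2 * T -> F u v = F1 u v.
  by rewrite /F /merge_fragments => ->.
have FR u v : F (l + g + u) v = F2 u v.
  by rewrite /F /merge_fragments !ifN; [congr F2; lia | lia | lia].
have NL u v : near T q1 u v -> u < l + 2 * T by case/(near_bound Hq).
have R u v : near T (q1 ++ map (addn (l + g)) q2) u v <->
   near T q1 u v \/ exists2 u', u = l + g + u' & near T q2 u' v.
  rewrite near_cat near_shift; split=> -[H|H]; try by left.
    by right; exists (u - (l + g)); [lia | case: H].
  by right; case: H => u' -> H; split; [lia | rewrite addKn].
apply: scene_eq => [|a|a b] /=.
- rewrite map_cat -map_comp -catA; congr (_ ++ (_ ++ _)).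
    by apply/eq_in_map => x /Hq Hx; apply: FL; lia.
  by apply: eq_map => x /=; rewrite -addnA FR.
- split.
    move=> [|[u [v [/R[N|[u' -> N]] <-]]]]; first by left; left.
      by left; right; exists u, v; rewrite FL //; apply: NL N.
    by right; exists u', v; rewrite FR.
  move=> [[|[u [v [N <-]]]]|[u [v [N <-]]]]; first by left.
    by right; exists u, v; rewrite FL; [split=> //; apply/R; left | apply: NL N].
  by right; exists (l + g + u), v; rewrite FR; split=> //; apply/R; right; exists u.
- split.
    move=> [|[u [v [u' [v' [/R[N|[w -> N]] /R[N'|[w' -> N']] <- <- D]]]]]].
    + by left; left.
    + by left; right; exists u, v, u', v'; rewrite !FL //; [apply: NL N' | apply: NL N].
    (* In the mixed cases the columns are below [l + 2 * T] and at least [l + g], hence at distance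
       at least 2. *)
    + by have := NL _ _ N; move: D; rewrite /dist1; lia.
    + by have := NL _ _ N'; move: D; rewrite /dist1; lia.
    + right; exists w, v, w', v'; rewrite !FR; split=> //.
      by move: D; rewrite /dist1; lia.
  move=> [[|[u [v [u' [v' [N N' <- <- D]]]]]]|[u [v [u' [v' [N N' <- <- D]]]]]].
  + by left.
  + right; exists u, v, u', v'; rewrite !FL; [|by apply: NL N'|by apply: NL N].
    by split=> //; apply/R; left.
  + right; exists (l + g + u), v, (l + g + u'), v'; rewrite !FR.
    split=> //; try by apply/R; right; eexists; eauto.
    by move: D; rewrite /dist1; lia.
Qed.

Lemma fragment_color_flip T A S F q r x : (forall x, x \in q -> x <= r) ->
  r - x \in q -> x <= r ->
  fragment_color T A S (flip_fragment T r F) (map (subn r) q) x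
  = fragment_color T A S F q (r - x).
Proof.
move=> Hq Hx Hxr; rewrite /fragment_color.
rewrite -[x in index x (map _ _)](subKn Hxr) take_index_map //.
  by rewrite add_flip_fragment // => y /mem_take /Hq.
by move=> a b /Hq Ha /Hq Hb; lia.
Qed.

Lemma fragment_color_mergel T A S l g B F1 F2 q1 q2 x :
  (forall x, x \in q1 -> x < l) -> 2 * T < g -> x \in q1 ->
  fragment_color T A S (merge_fragments T l g B F1 F2) (q1 ++ q2) x
  = fragment_color T A S F1 q1 x.
Proof.
move=> Hq Hg Hx; rewrite /fragment_color take_index_catl //.
have := @add_merge_fragments T S l g B F1 F2 (take (index x q1).+1 q1) [::] _ Hg.
by rewrite cats0 add_fragment_nil => -> // y /mem_take /Hq.
Qed.

(** The second fragment is colored in a scene that already holds the first, while [q3], used for the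
    gap nodes, comes too late to be seen. *)
Lemma fragment_color_merger T A S l g B F1 F2 q1 q2 q3 x :
  (forall x, x \in q1 -> x < l) -> 2 * T < g -> x \in q2 ->
  fragment_color T A S (merge_fragments T l g B F1 F2)
    (q1 ++ map (addn (l + g)) q2 ++ q3) (l + g + x)
  = fragment_color T A (add_fragment T S F1 q1) F2 q2 x.
Proof.
move=> Hq Hg Hx; rewrite /fragment_color take_index_catr; last first.
  by apply/negP => /Hq; lia.
rewrite take_index_catl ?map_f // take_index_map //.
  by rewrite add_merge_fragments.
by move=> a b _ _; lia.
Qed.

(** * Fragments with a large rise *)

Definition area (T l : nat) := (l + 2 * T) * (2 * T).+1.

(** Identifiers fill a block starting at [B] with as many values as the rectangle has cells.
    Consecutive blocks keep fragments disjoint and the total within the number of grid nodes. *)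
Record valid_fragment (T B l : nat) (F : nat -> nat -> nat) (q : seq nat) : Prop := {
  fragment_gt0 : 0 < l;
  fragment_perm : perm_eq q (iota 0 l);
  fragment_inj : forall u v u' v', u < l + 2 * T -> v <= 2 * T ->
    u' < l + 2 * T -> v' <= 2 * T -> F u v = F u' v' -> u = u' /\ v = v';
  fragment_range : forall u v, u < l + 2 * T -> v <= 2 * T ->
    B <= F u v < B + area T l }.

Lemma fragment_mem T B l F q x : valid_fragment T B l F q -> (x \in q) = (x < l).
Proof. by move=> V; rewrite (perm_mem (fragment_perm V)) mem_iota add0n. Qed.

Lemma row_major_inj w a b a' b' : b < w -> b' < w ->
  a * w + b = a' * w + b' -> a = a' /\ b = b'.
Proof.
move=> Hb Hb' E; have := edivn_eq a Hb; rewrite E edivn_eq //.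
by case.
Qed.

Lemma valid_fresh T B l : 0 < l ->
  valid_fragment T B l (fun u v => B + u * (2 * T).+1 + v) (iota 0 l).
Proof.
move=> Hl; split=> // [u v u' v' Hu Hv Hu' Hv' E|u v Hu Hv].
  by apply: (@row_major_inj (2 * T).+1); lia.
have : u.+1 * (2 * T).+1 <= area T l by rewrite leq_mul2r Hu orbT.
by rewrite mulSn; lia.
Qed.

Lemma valid_flip T B l F q : valid_fragment T B l F q ->
  valid_fragment T B l (flip_fragment T l.-1 F) (map (subn l.-1) q).
Proof.
move=> V; have M x := fragment_mem x V; have [Hl P I R] := V; split=> //.
- apply: uniq_perm; rewrite ?iota_uniq //.
    rewrite map_inj_in_uniq ?(perm_uniq P) ?iota_uniq // => a b.
    by rewrite !M; lia.
  move=> x; rewrite mem_iota add0n; apply/mapP/idP => [[y]|Hx].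
    by rewrite M; lia.
  by exists (l.-1 - x); rewrite ?M; lia.
- move=> u v u' v' Hu Hv Hu' Hv' /I.
  by case; lia.
- by move=> u v Hu Hv; apply: R; lia.
Qed.

Lemma area_merge T l1 g l2 : 2 * T <= g ->
  area T (l1 + g + l2) = area T l1 + area T l2 + (g - 2 * T) * (2 * T).+1.
Proof. by move=> Hg; rewrite /area -!mulnDl; congr (_ * _); lia. Qed.

(** The blocks of the two pieces and of the columns between them are consecutive, and their sizes
    add up to the area of the merged rectangle. *)
Lemma valid_merge T B l1 l2 g F1 F2 q1 q2 :
  valid_fragment T B l1 F1 q1 -> valid_fragment T (B + area T l1) l2 F2 q2 ->
  2 * T < g ->
  valid_fragment T B (l1 + g + l2)
    (merge_fragments T l1 g (B + area T l1 + area T l2) F1 F2)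
    (q1 ++ map (addn (l1 + g)) q2 ++ iota l1 g).
Proof.
move=> V1 V2 Hg.
have M1 x := fragment_mem x V1; have M2 x := fragment_mem x V2.
have [Hl1 P1 I1 R1] := V1; have [Hl2 P2 I2 R2] := V2.
have RM u v : l1 + 2 * T <= u -> u < l1 + g -> v <= 2 * T ->
    (u - (l1 + 2 * T)) * (2 * T).+1 + v < (g - 2 * T) * (2 * T).+1.
  move=> H1 H2 Hv.
  have : (u - (l1 + 2 * T)).+1 * (2 * T).+1 <= (g - 2 * T) * (2 * T).+1.
    by rewrite leq_mul2r; lia.
  by rewrite mulSn; lia.
split; first by lia.
- apply: (@perm_trans _ (iota 0 l1 ++ map (addn (l1 + g)) (iota 0 l2) ++ iota l1 g)).
    by apply: perm_cat => //; rewrite perm_cat2r perm_map.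
  rewrite -iotaDl addn0 (iotaD 0 (l1 + g)) (iotaD 0 l1) -catA perm_cat2l.
  by rewrite perm_catC.
- move=> u v u' v' Hu Hv Hu' Hv'; rewrite /merge_fragments.
  case: (ltnP u (l1 + 2 * T)) => H1; [|case: (ltnP u (l1 + g)) => H2];
  (case: (ltnP u' (l1 + 2 * T)) => H1'; [|case: (ltnP u' (l1 + g)) => H2']).
  + exact: I1.
  + by have := R1 u v H1 Hv; lia.
  + by have := R1 u v H1 Hv; have := R2 (u' - (l1 + g)) v' ltac:(lia) Hv'; lia.
  + by have := R1 u' v' H1' Hv'; lia.
  + move=> E.
    have [] := @row_major_inj (2 * T).+1 (u - (l1 + 2 * T)) v (u' - (l1 + 2 * T)) v';
      lia.
  + by have := R2 (u' - (l1 + g)) v' ltac:(lia) Hv'; lia.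
  + by have := R1 u' v' H1' Hv'; have := R2 (u - (l1 + g)) v ltac:(lia) Hv; lia.
  + by have := R2 (u - (l1 + g)) v ltac:(lia) Hv; lia.
  + by case/I2; lia.
- move=> u v Hu Hv; rewrite area_merge ?(ltnW Hg) // /merge_fragments.
  have := RM u v; move: ((g - 2 * T) * _) => X RMuv.
  case: (ltnP u (l1 + 2 * T)) => H1; [|case: (ltnP u (l1 + g)) => H2].
  + by have := R1 u v H1 Hv; lia.
  + by move: (RMuv H1 H2 Hv); move: ((u - _) * _) => Y; lia.
  + by have := R2 (u - (l1 + g)) v ltac:(lia) Hv; lia.
Qed.

(** Properness is a premise because it becomes available only once the fragment is placed in a
    grid. *)
Definition rises T A S l F q i j k :=
  proper_upto (fragment_color T A S F q) l ->
  (Z.of_nat k <= height (fragment_color T A S F q) j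
                 - height (fragment_color T A S F q) i)%Z.

Lemma height_flip T A S B l F q x : valid_fragment T B l F q -> x < l ->
  height (fragment_color T A S (flip_fragment T l.-1 F) (map (subn l.-1) q)) x
  = (height (fragment_color T A S F q) (l.-1 - x)%nat
     - height (fragment_color T A S F q) l.-1)%Z.
Proof.
move=> V Hx; have M y := fragment_mem y V; rewrite -height_rev; last by lia.
apply: eq_height => y Hy; apply: fragment_color_flip; rewrite ?M; try lia.
by move=> z; rewrite M; lia.
Qed.

(** If the rise runs from right to left, the reflected fragment has it from left to right. *)
Lemma orient_rise T A S B l F q i j k :
  valid_fragment T B l F q -> i < l -> j < l -> rises T A S l F q i j k ->
  exists F' q' i' j', [/\ valid_fragment T B l F' q', i' <= j', j' < l
    & rises T A S l F' q' i' j' k].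
Proof.
move=> V Hi Hj H; case: (leqP i j) => Hij; first by exists F, q, i, j.
exists (flip_fragment T l.-1 F), (map (subn l.-1) q), (l.-1 - i), (l.-1 - j).
split; [exact: valid_flip | lia | lia |] => P.
rewrite !(height_flip A S V) ?subKn; try lia.
suff /H : proper_upto (fragment_color T A S F q) l by lia.
move=> x Hx; have := P (l.-1 - x.+1).
have M y := fragment_mem y V.
have Hq y : y \in q -> y <= l.-1 by rewrite M; lia.
rewrite !(fragment_color_flip T A S F Hq) ?M; try lia.
have -> : l.-1 - (l.-1 - x.+1) = x.+1 by lia.
have -> : l.-1 - (l.-1 - x.+1).+1 = x by lia.
by rewrite eq_sym; apply; lia.
Qed.

(* Two pieces rising by [k] are joined across a gap of [2T+1] or [2T+2] nodes,
   the smallest ones keeping their views disjoint and nonadjacent. *)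
Lemma rising_fragment T A k S B : exists l F q i j,
  [/\ valid_fragment T B l F q, l + 2 * T + 2 <= 2 ^ k * (2 * T + 3),
      i <= j, j < l & rises T A S l F q i j k].
Proof.
elim: k S B => [|k IH] S B.
  exists 1, (fun u v => B + u * (2 * T).+1 + v), (iota 0 1), 0, 0.
  by split; [apply: valid_fresh | | | |move=> _] => //=; lia.
have [l1 [F1 [q1 [i1 [j1 [V1 L1 H1 Hj1 R1]]]]]] := IH S B.
(* The second piece is built against the scene containing the first, with the next block of
   identifiers. *)
have [l2 [F2 [q2 [i2 [j2 [V2 L2 H2 Hj2 R2]]]]]] :=
  IH (add_fragment T S F1 q1) (B + area T l1).
(* [l1 + g + i2 - j1] is the distance between the two rising spans; [g] gives it the parity opposite
   to that of [k]. *)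
pose g := if odd (l1 + (2 * T).+1 + i2 - j1 + k) then (2 * T).+1 else (2 * T).+2.
have Hg : 2 * T < g <= (2 * T).+2 by rewrite /g; case: ifP; lia.
have Hodd : odd (l1 + g + i2 - j1 + k).
  rewrite /g; case: ifP => // E.
  have -> : l1 + (2 * T).+2 + i2 - j1 + k = (l1 + (2 * T).+1 + i2 - j1 + k).+1 by lia.
  by rewrite oddS E.
have V := valid_merge V1 V2 (proj1 (andP Hg)).
set F := merge_fragments _ _ _ _ _ _ in V; set q := q1 ++ _ in V.
have M1 y := fragment_mem y V1; have M2 y := fragment_mem y V2.
have Hq1 x : x \in q1 -> x < l1 by rewrite M1.
set c := fragment_color T A S F q.
have cl x : x < l1 -> c x = fragment_color T A S F1 q1 x.
  by move=> Hx; apply: fragment_color_mergel => //; rewrite ?M1; lia.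
have cr x : x < l2 ->
    c (l1 + g + x) = fragment_color T A (add_fragment T S F1 q1) F2 q2 x.
  by move=> Hx; apply: fragment_color_merger => //; rewrite ?M2; lia.
suff [i [j [Hi Hj R]]] : exists i j, [/\ i < l1 + g + l2, j < l1 + g + l2
    & rises T A S (l1 + g + l2) F q i j k.+1].
  have [F' [q' [i' [j' [V' Hij' Hj' R']]]]] := orient_rise V Hi Hj R.
  exists (l1 + g + l2), F', q', i', j'; split=> //.
  (* Since [g <= 2 * T + 2], the quantity [l + 2 * T + 2] for the merged piece is at most the sum of
     those for the two halves. *)
  by rewrite Nat.pow_succ_r'; lia.
(* Without properness [rises] holds vacuously. *)
case: (pselect (proper_upto c (l1 + g + l2))) => P; last first.
  by exists 0, 0; split; [lia | lia | move/P].
suff [i [j [Hi Hj R]]] : exists i j, [/\ i < l1 + g + l2, j < l1 + g + l2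
    & (Z.of_nat k.+1 <= height c j - height c i)%Z] by exists i, j; split.
apply: (merge_heights (i1 := i1) (j1 := j1) (i2 := l1 + g + i2) (j2 := l1 + g + j2)
  P) => //; try lia.
- rewrite !(eq_height (c := c) (c' := fragment_color T A S F1 q1)); first apply: R1.
  + by move=> x Hx; rewrite -!cl; [apply: P | |]; lia.
  + by move=> x Hx; apply: cl; lia.
  + by move=> x Hx; apply: cl; lia.
- have /R2 : proper_upto (fragment_color T A (add_fragment T S F1 q1) F2 q2) l2.
    by move=> x Hx; rewrite -!cr ?addnS; [apply: P | |]; lia.
  have E x : x < l2 -> height (fragment_color T A (add_fragment T S F1 q1) F2 q2) x
      = (height c (l1 + g + x)%nat - height c (l1 + g)%nat)%Z.
    by move=> Hx; rewrite -height_shift; apply: eq_height => y Hy; rewrite cr //; lia.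
  by rewrite !E; lia.
Qed.

(** * Placing two fragments in the grid *)

Lemma extend_injection (V : finType) (D : {set V}) (f : V -> nat) :
  {in D &, injective f} -> (forall v, v \in D -> 1 <= f v <= #|V|) ->
  exists id : V -> nat,
    [/\ injective id, forall v, 1 <= id v <= #|V| & {in D, id =1 f}].
Proof.
move=> inj ran; pose used := [seq f v | v <- enum D].
pose free := [seq a <- iota 1 #|V| | a \notin used].
have Uused : uniq used.
  by rewrite map_inj_in_uniq ?enum_uniq // => a b; rewrite !mem_enum; apply: inj.
have Ufree : uniq free by rewrite filter_uniq ?iota_uniq.
have Sfree : size free = size (enum (~: D)).
  have : perm_eq (iota 1 #|V|) (used ++ free).
    apply: uniq_perm; rewrite ?iota_uniq ?cat_uniq ?Uused ?Ufree ?andbT //=.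
      by apply/hasPn => a; rewrite mem_filter => /andP[].
    move=> a; rewrite mem_cat mem_filter.
    case: (boolP (a \in used)) => //= /mapP[v]; rewrite mem_enum => /ran H ->.
    by rewrite mem_iota add1n ltnS H.
  move/perm_size; rewrite size_iota size_cat size_map -!cardE -(cardsC D).
  by move/addnI.
(* The default 0 is never reached, since the index stays below [size free]. *)
pose id v := if v \in D then f v else nth 0 free (index v (enum (~: D))).
have idx v : v \notin D -> index v (enum (~: D)) < size free.
  by move=> Hv; rewrite Sfree index_mem mem_enum inE.
have idN v : v \notin D -> id v \in free.
  by move=> Hv; rewrite /id (negbTE Hv) mem_nth ?idx.
have fused v : v \in D -> f v \in used by move=> Hv; rewrite map_f // mem_enum.
exists id; split.
- move=> v w; case: (boolP (v \in D)) => Hv; case: (boolP (w \in D)) => Hw.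
  + by rewrite /id Hv Hw; apply: inj.
  + by move=> E; have := idN _ Hw; rewrite -E {1}/id Hv mem_filter fused.
  + by move=> E; have := idN _ Hv; rewrite E {1}/id Hw mem_filter fused.
  + rewrite /id (negbTE Hv) (negbTE Hw) => /eqP.
    rewrite nth_uniq ?idx // => /eqP E.
    have Mv : v \in enum (~: D) by rewrite mem_enum inE.
    have Mw : w \in enum (~: D) by rewrite mem_enum inE.
    by rewrite -(nth_index v Mv) E nth_index.
- move=> v; case: (boolP (v \in D)) => Hv; first by rewrite /id Hv; apply: ran.
  by have := idN _ Hv; rewrite mem_filter mem_iota => /andP[_]; lia.
- by move=> v Hv; rewrite /id Hv.
Qed.

Definition node m' a b : gnode m'.+1 := (inord a, inord b).

Lemma node1 m' a b : a <= m' -> (node m' a b).1 = a :> nat.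
Proof. exact: inordK. Qed.

Lemma node2 m' a b : b <= m' -> (node m' a b).2 = b :> nat.
Proof. exact: inordK. Qed.

Lemma node_adj m' a b a' b' : a <= m' -> b <= m' -> a' <= m' -> b' <= m' ->
  grid_adj (node m' a b) (node m' a' b') = (dist1 a b a' b' == 1).
Proof. by move=> *; rewrite /grid_adj /= !inordK. Qed.

(** A step from [y] towards [x] in a differing coordinate never leaves the grid, so borders do not
    lengthen distances. *)
Lemma within_grid m' T (x y : gnode m'.+1) :
  within (@grid_adj m'.+1) T x y = (dist1 x.1 x.2 y.1 y.2 <= T).
Proof.
case: x => x1 x2; elim: T y => [|T IH] [y1 y2] /=.
  apply/eqP/idP => [[-> ->]|]; rewrite /dist1; first by lia.
  by move=> H; congr pair; apply: val_inj => /=; lia.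
rewrite IH; apply/orP/idP => [[|/existsP[[z1 z2]]]|H] /=.
- exact: leqW.
- by rewrite IH /grid_adj /dist1 /= => /andP[H /eqP]; lia.
case: (leqP (dist1 x1 x2 y1 y2) T) => [|H']; [by left | right].
apply/existsP; move: H H'; rewrite /dist1 /= => H H'.
have := ltn_ord x1; have := ltn_ord x2; have := ltn_ord y1; have := ltn_ord y2.
move=> by2 by1 bx2 bx1.
suff [a [b [Ha Hb Hd Hadj]]] : exists a b, [/\ a <= m', b <= m',
    dist1 x1 x2 a b <= T & dist1 a b y1 y2 = 1].
  by exists (node m' a b); rewrite IH /grid_adj /= !inordK // Hd; apply/eqP.
rewrite /dist1; case: (ltngtP x1 y1) => H1; last case: (ltngtP x2 y2) => H2.
- by exists y1.-1, (y2 : nat); split; lia.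
- by exists y1.+1, (y2 : nat); split; lia.
- by exists (y1 : nat), y2.-1; split; lia.
- by exists (y1 : nat), y2.+1; split; lia.
- by lia.
Qed.

Definition grid_scene m T (id : gnode m -> nat) (p : seq (gnode m)) :=
  let W := in_ball (@grid_adj m) p T in
  Scene (map id p) (fun a => exists u, W u /\ id u = a)
    (fun a b => exists u w, [/\ W u, W w, id u = a, id w = b & grid_adj u w]).

(** Reduces the model to scenes: equal scenes force equal colors. *)
Lemma online_coloringE m T A (id : gnode m -> nat) s v :
  online_coloring T A id s v = answer A (grid_scene T id (take (index v s).+1 s)).
Proof.
rewrite /online_coloring /answer /=; congr A.
- apply: funext => a; apply/existsP/asboolP => -[u].
    by case/andP=> H /eqP E; exists u.
  by case=> H E; exists u; rewrite H; apply/eqP.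
- apply: funext => a; apply: funext => b; apply/existsP/asboolP => -[u].
    by case/existsP=> w /and5P[H1 H2 /eqP E1 /eqP E2 H3]; exists u, w.
  case=> w [H1 H2 /eqP E1 /eqP E2 H3]; exists u; apply/existsP; exists w.
  by apply/and5P.
Qed.

Lemma dist1_sub o p a b a' b' : o <= a -> p <= b -> o <= a' -> p <= b' ->
  dist1 (a - o) (b - p) (a' - o) (b' - p) = dist1 a b a' b'.
Proof. by rewrite /dist1; lia. Qed.

(** * Two segments in parallel rows of the grid *)

Section Embedding.

Variables (m' T l1 l2 o : nat) (F1 F2 : nat -> nat -> nat).
Hypotheses (fit1 : l1 + 2 * T <= m'.+1) (fit2 : o + l2 + 2 * T <= m'.+1)
  (fitT : 4 * T + 2 <= m').

(** The balls of the two segments lie in rows 0 to [2 * T] and [2 * T + 2] to [4 * T + 2]; the row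
    between them excludes edges from one to the other. *)
Let pos1 x := node m' (x + T) T.
Let pos2 x := node m' (o + x + T) (3 * T + 2).

Lemma in_ball_embedding (q1 q2 : seq nat) (u : gnode m'.+1) :
  (forall x, x \in q1 -> x < l1) -> (forall x, x \in q2 -> x < l2) ->
  in_ball (@grid_adj m'.+1) (map pos1 q1 ++ map pos2 q2) T u <->
  near T q1 u.1 u.2 \/
  [/\ o <= u.1, 2 * T + 2 <= u.2 & near T q2 (u.1 - o) (u.2 - (2 * T + 2))].
Proof.
move=> Hq1 Hq2; rewrite /in_ball has_cat; split=> [/orP[]|[|[]]].
- case/hasP=> _ /mapP[x Hx ->]; rewrite within_grid => H; left; exists x => //.
  by have := Hq1 _ Hx => Hl; rewrite node1 ?node2 // in H; lia.
- case/hasP=> _ /mapP[x Hx ->]; rewrite within_grid => H; right.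
  have := Hq2 _ Hx => Hl; rewrite node1 ?node2 /dist1 in H; try lia.
  by split; try lia; exists x => //; rewrite /dist1; lia.
- case=> x Hx H; have := Hq1 _ Hx => Hl; apply/orP; left; apply/hasP.
  by exists (pos1 x); rewrite ?map_f // within_grid node1 ?node2 //; lia.
- move=> H1 H2 [x Hx H]; have := Hq2 _ Hx => Hl; apply/orP; right; apply/hasP.
  exists (pos2 x); rewrite ?map_f // within_grid node1 ?node2; try lia.
  by move: H; rewrite /dist1; lia.
Qed.

Lemma grid_scene_embedding (id : gnode m'.+1 -> nat) (q1 q2 : seq nat) :
  (forall u v, u < l1 + 2 * T -> v <= 2 * T -> id (node m' u v) = F1 u v) ->
  (forall u v, u < l2 + 2 * T -> v <= 2 * T ->
     id (node m' (o + u) (2 * T + 2 + v)) = F2 u v) ->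
  (forall x, x \in q1 -> x < l1) -> (forall x, x \in q2 -> x < l2) ->
  grid_scene T id (map pos1 q1 ++ map pos2 q2)
  = add_fragment T (add_fragment T scene0 F1 q1) F2 q2.
Proof.
move=> id1 id2 Hq1 Hq2.
have B u := @in_ball_embedding q1 q2 u Hq1 Hq2.
have N1 u v : near T q1 u v -> u < l1 + 2 * T /\ v <= 2 * T by apply: near_bound.
have N2 u v : near T q2 u v -> u < l2 + 2 * T /\ v <= 2 * T by apply: near_bound.
have nodeE (u : gnode m'.+1) : u = node m' u.1 u.2.
  by case: u => a b; rewrite /node !inord_val.
have nodeE2 (u : gnode m'.+1) : o <= u.1 -> 2 * T + 2 <= u.2 ->
    u = node m' (o + (u.1 - o)) (2 * T + 2 + (u.2 - (2 * T + 2))).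
  by move=> H1 H2; rewrite [LHS]nodeE; congr node; lia.
have W1 u v : near T q1 u v ->
    in_ball (@grid_adj m'.+1) (map pos1 q1 ++ map pos2 q2) T (node m' u v).
  move=> N; apply/B; left; have [Hu Hv] := N1 _ _ N.
  by rewrite node1 ?node2 //; lia.
have W2 u v : near T q2 u v ->
    in_ball (@grid_adj m'.+1) (map pos1 q1 ++ map pos2 q2) T
      (node m' (o + u) (2 * T + 2 + v)).
  move=> N; apply/B; right; have [Hu Hv] := N2 _ _ N.
  by rewrite node1 ?node2 ?addKn; try lia; split=> //; lia.
have I1 (u : gnode m'.+1) : near T q1 u.1 u.2 -> id u = F1 u.1 u.2.
  by move=> /N1[? ?]; rewrite {1}(nodeE u) id1.
have I2 (u : gnode m'.+1) : o <= u.1 -> 2 * T + 2 <= u.2 ->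
    near T q2 (u.1 - o) (u.2 - (2 * T + 2)) ->
    id u = F2 (u.1 - o) (u.2 - (2 * T + 2)).
  by move=> Ho Hv /N2[? ?]; rewrite {1}(nodeE2 u) // id2.
apply: scene_eq => [|a|a b] /=.
- rewrite map_cat -!map_comp; congr (_ ++ _); apply/eq_in_map => x.
    by move/Hq1 => Hx /=; rewrite id1 //; lia.
  move/Hq2 => Hx /=; rewrite -id2; try lia.
  by congr (id (node m' _ _)); lia.
- split=> [[u [/B[N|[Ho Hv N]] <-]]|[[//|[u [v [N <-]]]]|[u [v [N <-]]]]].
  + by left; right; exists u.1, u.2; rewrite -I1.
  + by right; exists (u.1 - o), (u.2 - (2 * T + 2)); rewrite -I2.
  + have [Hu Hv] := N1 _ _ N.
    by exists (node m' u v); split; [apply: W1 | rewrite id1].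
  + have [Hu Hv] := N2 _ _ N.
    by exists (node m' (o + u) (2 * T + 2 + v)); split; [apply: W2 | rewrite id2].
- split=> [[u [w [/B Bu /B Bw <- <- /eqP D]]]|].
    case: Bu Bw => [N|[Ho Hv N]] [N'|[Ho' Hv' N']].
    + left; right; exists u.1, u.2, w.1, w.2; rewrite -!I1 //.
    + by have [] := N1 _ _ N; move: D; lia.
    + by have [] := N1 _ _ N'; move: D; lia.
    + right; exists (u.1 - o), (u.2 - (2 * T + 2)), (w.1 - o), (w.2 - (2 * T + 2)).
      by rewrite -!I2 //; split=> //; rewrite dist1_sub.
  move=> [[//|[u [v [u' [v' [N N' <- <- D]]]]]]|[u [v [u' [v' [N N' <- <- D]]]]]].
  + have [Hu Hv] := N1 _ _ N; have [Hu' Hv'] := N1 _ _ N'.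
    exists (node m' u v), (node m' u' v'); rewrite !id1 //.
    split=> //; try exact: W1.
    by rewrite node_adj ?D //; lia.
  + have [Hu Hv] := N2 _ _ N; have [Hu' Hv'] := N2 _ _ N'.
    exists (node m' (o + u) (2 * T + 2 + v)), (node m' (o + u') (2 * T + 2 + v')).
    rewrite !id2 //; split=> //; try exact: W2.
    by rewrite node_adj; try lia; move: D; rewrite /dist1; lia.
Qed.

(** The adversary names the two rectangles by [F1] and [F2], completes the identifiers, and presents
    [q1], [q2], then all other nodes. The algorithm meets exactly the scenes in which the fragments
    were colored. *)
Lemma grid_embedding A idmax q1 q2 :
  solves_grid_3col m'.+1 idmax T A -> m'.+1 * m'.+1 <= idmax ->
  valid_fragment T 1 l1 F1 q1 -> valid_fragment T (1 + area T l1) l2 F2 q2 ->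
  area T l1 + area T l2 <= m'.+1 * m'.+1 ->
  exists c : nat -> nat -> 'I_3, [/\
    forall x y, x.+1 < m'.+1 -> y < m'.+1 -> c x y != c x.+1 y,
    forall x y, x < m'.+1 -> y.+1 < m'.+1 -> c x y != c x y.+1,
    forall x, x < l1 -> c (x + T) T = fragment_color T A scene0 F1 q1 x
  & forall x, x < l2 -> c (o + x + T) (3 * T + 2)
      = fragment_color T A (add_fragment T scene0 F1 q1) F2 q2 x].
Proof.
move=> Hsol Hmax V1 V2 Harea.
have M1 x := fragment_mem x V1; have M2 x := fragment_mem x V2.
have [_ P1 J1 R1] := V1; have [_ P2 J2 R2] := V2.
pose D1 (v : gnode m'.+1) := (v.1 < l1 + 2 * T) && (v.2 <= 2 * T).
pose D2 (v : gnode m'.+1) := [&& o <= v.1, v.1 < o + (l2 + 2 * T),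
  2 * T + 2 <= v.2 & v.2 <= 4 * T + 2].
pose f (v : gnode m'.+1) :=
  if v.2 <= 2 * T then F1 v.1 v.2 else F2 (v.1 - o) (v.2 - (2 * T + 2)).
have cardV : #|gnode m'.+1| = m'.+1 * m'.+1 by rewrite card_prod card_ord.
have f1 v : D1 v -> f v = F1 v.1 v.2 by rewrite /f => /andP[_ ->].
have f2 v : D2 v -> f v = F2 (v.1 - o) (v.2 - (2 * T + 2)).
  by rewrite /D2 /f => H; rewrite ifN //; lia.
have r1 v : D1 v -> 1 <= f v < 1 + area T l1.
  by move=> H; rewrite f1 //; case/andP: H; apply: R1.
have r2 v : D2 v -> 1 + area T l1 <= f v < 1 + area T l1 + area T l2.
  by move=> H; rewrite f2 //; case/and4P: H => *; apply: R2; lia.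
have [id [Iinj Iran Idef]] : exists id : gnode m'.+1 -> nat, [/\ injective id,
    forall v, 1 <= id v <= #|gnode m'.+1| & {in [set v | D1 v || D2 v], id =1 f}].
  apply: extend_injection => [v w|v]; rewrite !inE; last first.
    by rewrite cardV => /orP[/r1|/r2]; lia.
  have E (a b : gnode m'.+1) :
      a.1 = b.1 :> nat -> a.2 = b.2 :> nat -> a = b.
    by case: a b => [? ?] [? ?] /= /val_inj -> /val_inj ->.
  case/orP=> Hv /orP[] Hw.
  - rewrite !f1 // => Ef; case/andP: Hv => Hv1 Hv2; case/andP: Hw => Hw1 Hw2.
    by have [] := J1 _ _ _ _ Hv1 Hv2 Hw1 Hw2 Ef; apply: E.
  - by have := r1 _ Hv; have := r2 _ Hw; lia.
  - by have := r1 _ Hw; have := r2 _ Hv; lia.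
  - rewrite !f2 // => Ef.
    case/and4P: Hv => Hv1 Hv2 Hv3 Hv4; case/and4P: Hw => Hw1 Hw2 Hw3 Hw4.
    have [] := J2 _ _ _ _ _ _ _ _ Ef; try lia.
    by move=> E1 E2; apply: E; lia.
have id1 u v : u < l1 + 2 * T -> v <= 2 * T -> id (node m' u v) = F1 u v.
  move=> Hu Hv; have H : D1 (node m' u v) by rewrite /D1 node1 ?node2; lia.
  by rewrite Idef ?inE ?H // f1 // node1 ?node2 //; lia.
have id2 u v : u < l2 + 2 * T -> v <= 2 * T ->
    id (node m' (o + u) (2 * T + 2 + v)) = F2 u v.
  move=> Hu Hv; have H : D2 (node m' (o + u) (2 * T + 2 + v)).
    by rewrite /D2 node1 ?node2; lia.
  by rewrite Idef ?inE ?H ?orbT // f2 // node1 ?node2 ?addKn //; lia.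
pose s0 := map pos1 q1 ++ map pos2 q2.
pose s := s0 ++ [seq v <- enum (gnode m'.+1) | v \notin s0].
have pos1_inj : {in q1 &, injective pos1}.
  move=> x y; rewrite !M1 => Hx Hy /(congr1 (fun v : gnode _ => v.1 : nat)).
  by rewrite !node1; lia.
have pos2_inj : {in q2 &, injective pos2}.
  move=> x y; rewrite !M2 => Hx Hy /(congr1 (fun v : gnode _ => v.1 : nat)).
  by rewrite !node1; lia.
have pos12 x : x < l2 -> pos2 x \notin map pos1 q1.
  move=> Hx; apply/mapP=> -[y]; rewrite M1 => Hy.
  by move=> /(congr1 (fun v : gnode _ => v.2 : nat)); rewrite !node2; lia.
have Us0 : uniq s0.
  rewrite cat_uniq !map_inj_in_uniq // (perm_uniq P1) (perm_uniq P2) !iota_uniq.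
  rewrite andbT /=; apply/hasPn => _ /mapP[x Hx ->].
  by apply: pos12; rewrite -M2.
have Hs : valid_order s.
  apply: uniq_perm; rewrite ?enum_uniq //.
    rewrite cat_uniq Us0 filter_uniq ?enum_uniq // andbT /=.
    by apply/hasPn => v; rewrite mem_filter => /andP[].
  by move=> v; rewrite mem_cat mem_filter mem_enum; case: (v \in s0).
have Hid : valid_ids idmax id.
  by split=> // v; have := Iran v; rewrite cardV; lia.
have Hprop := Hsol id s Hid Hs.
exists (fun x y => online_coloring T A id s (node m' x y)); split.
- move=> x y Hx Hy; apply: Hprop; rewrite node_adj /dist1; lia.
- move=> x y Hx Hy; apply: Hprop; rewrite node_adj /dist1; lia.
- move=> x Hx; rewrite online_coloringE -/(pos1 x).
  have Hq : x \in q1 by rewrite M1.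
  rewrite /s /s0 -catA take_index_catl ?map_f // take_index_map //.
  (* During the first segment nothing of the second has been shown, so its prefix is empty. *)
  rewrite -[map _ _]cats0 (@grid_scene_embedding id _ [::]) ?add_fragment_nil //.
  by move=> y /mem_take; rewrite M1.
- move=> x Hx; rewrite online_coloringE -/(pos2 x).
  have Hq : x \in q2 by rewrite M2.
  rewrite /s /s0 -catA take_index_catr ?pos12 //.
  rewrite take_index_catl ?map_f // take_index_map //.
  rewrite (@grid_scene_embedding id) // => y; first by rewrite M1.
  by move=> /mem_take; rewrite M2.
Qed.

End Embedding.

(** * The lower bound *)

(** Reversal negates the total rise, so one of the two orientations does not rise. *)
Lemma falling_fragment T A S B l : 0 < l -> exists F q,
  valid_fragment T B l F q /\ (height (fragment_color T A S F q) l.-1 <= 0)%Z.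
Proof.
move=> Hl; have V := valid_fresh T B Hl; set F := fun _ => _ in V.
have Hl1 : l.-1 < l by lia.
case: (Z.le_gt_cases (height (fragment_color T A S F (iota 0 l)) l.-1) 0) => H.
  by exists F, (iota 0 l).
exists (flip_fragment T l.-1 F), (map (subn l.-1) (iota 0 l)); split.
  exact: valid_flip.
by rewrite (height_flip A S V Hl1) subnn /=; lia.
Qed.

(** Rows [T] and [3 * T + 2] are [2 * T + 2] apart, which allows rises to differ by at most
    [4 * T + 4]; the first span rises by one more than that while the second does not rise. *)
Lemma locality_obstruction m T A idmax :
  2 ^ (4 * T + 5) * (2 * T + 3) <= m -> m * m <= idmax ->
  ~ solves_grid_3col m idmax T A.
Proof.
case: m => [|m']; first by have := Nat.pow_nonzero 2 (4 * T + 5); nia.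
move=> Hm Hmax Hsol.
have [l1 [F1 [q1 [i [j [V1 L1 Hij Hj R]]]]]] :=
  rising_fragment T A (4 * T + 5) scene0 1.
have [F2 [q2 [V2 H2]]] := @falling_fragment T A (add_fragment T scene0 F1 q1)
  (1 + area T l1) (j - i).+1 (ltn0Sn _).
have HT : 4 * T + 2 <= m'.
  have : 2 ^ 1 <= 2 ^ (4 * T + 5) by apply/leP; apply: Nat.pow_le_mono_r; lia.
  by move: Hm; move: (2 ^ (4 * T + 5)) => X; rewrite /=; nia.
have Ha l : l + 2 * T <= m'.+1 -> area T l <= m'.+1 * (2 * T).+1.
  by move=> H; rewrite leq_mul2r H orbT.
have Harea : area T l1 + area T (j - i).+1 <= m'.+1 * m'.+1.
  have := Ha l1 ltac:(lia); have := Ha (j - i).+1 ltac:(lia).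
  have : m'.+1 * (2 * T).+1 + m'.+1 * (2 * T).+1 <= m'.+1 * m'.+1.
    by rewrite -mulnDr leq_mul2l; lia.
  by lia.
(* The offset [i] puts the second segment opposite the span from [i] to [j] of the first. *)
have [c [Ch Cv C1 C2]] := @grid_embedding m' T l1 (j - i).+1 i F1 F2
  ltac:(lia) ltac:(lia) HT A idmax q1 q2 Hsol Hmax V1 V2 Harea.
pose c' x y := c (i + x + T) y.
(* Properness of the grid coloring discharges the premise of [rises]. *)
have /R : proper_upto (fragment_color T A scene0 F1 q1) l1.
  by move=> x Hx; rewrite -!C1 ?addSn; [apply: Ch | |]; lia.
have := @grid_height_gap c' (m'.+1 - (i + T)) m'.+1 T (2 * T + 2) (j - i).
have -> : T + (2 * T + 2) = 3 * T + 2 by lia.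
have -> : height (c'^~ T) (j - i) = (height (fragment_color T A scene0 F1 q1) j -
    height (fragment_color T A scene0 F1 q1) i)%Z.
  rewrite -[in RHS](subnKC Hij) -height_shift; apply: eq_height => x Hx.
  by rewrite /c' C1 //; lia.
have -> : height (c'^~ (3 * T + 2)) (j - i) = height
    (fragment_color T A (add_fragment T scene0 F1 q1) F2 q2) (j - i).
  by apply: eq_height => x Hx; rewrite /c' C2 //; lia.
rewrite /= in H2; move=> G V.
suff : (Z.abs (height (fragment_color T A (add_fragment T scene0 F1 q1) F2 q2) (j - i)
  - (height (fragment_color T A scene0 F1 q1) j
     - height (fragment_color T A scene0 F1 q1) i)) <= 2 * Z.of_nat (2 * T + 2))%Z
  by lia.
apply: G => [x y Hx Hy|x y Hx Hy||]; try lia.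
- by rewrite /c' addnS addSn; apply: Ch; lia.
- by apply: Cv; lia.
Qed.

(** * Comparison with the logarithm *)

Lemma pow2_le_exp n : (INR (2 ^ n) <= exp (INR n))%R.
Proof.
rewrite pow_INR; elim: n => [|n IH]; first by rewrite /= exp_0; lra.
rewrite [INR n.+1]S_INR exp_plus -tech_pow_Rmult Rmult_comm.
have E : (2 <= exp 1)%R by have := exp_ineq1_le 1; lra.
apply: Rmult_le_compat => //; last by rewrite /=; lra.
by apply: pow_le; rewrite /=; lra.
Qed.

Lemma small_locality m T :
  (exp 32 <= INR (m * m))%R -> (INR T < 1 / 20 * ln (INR (m * m)))%R ->
  2 ^ (4 * T + 5) * (2 * T + 3) <= m.
Proof.
move=> Hm HT.
have Hm0 : (0 < INR m)%R.
  case: m Hm {HT} => [|m] H; last by apply: lt_0_INR; lia.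
  by move: H; have := exp_pos 32; rewrite /=; lra.
have Elog : ln (INR (m * m)) = (2 * ln (INR m))%R.
  by rewrite mult_INR ln_mult //; lra.
have H32 : (32 <= ln (INR (m * m)))%R.
  apply: Rnot_lt_le => /exp_increasing; rewrite exp_ln; first by lra.
  by have := exp_pos 32; lra.
(* With [L = ln (m * m) >= 32], one has [5 * T < L / 4] and [7 < L / 4], so
   [5 * T + 7 < L / 2 = ln m]. *)
have P : 2 ^ (5 * T + 7) <= m.
  apply/leP; apply: INR_le; apply: Rle_trans (pow2_le_exp _) _.
  rewrite -(exp_ln _ Hm0); left; apply: exp_increasing.
  by rewrite plus_INR mult_INR /=; lra.
apply: leq_trans P.
have -> : 5 * T + 7 = (4 * T + 5) + (T + 2) by lia.
rewrite (Nat.pow_add_r 2 (4 * T + 5) (T + 2)); apply: leq_mul => //.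
(* What remains is [2 * T + 3 <= 2 ^ (T + 2)]. *)
elim: T {HT} => [//|T IH].
by rewrite addSn Nat.pow_succ_r'; lia.
Qed.

Theorem theorem1 :
  exists c : R, (0 < c)%R /\
  forall k : nat, 1 <= k ->
  exists N0 : nat, forall (m T : nat) (A : online_alg),
    N0 <= m * m ->
    solves_grid_3col m ((m * m) ^ k) T A ->
    (c * ln (INR (m * m)) <= INR T)%R.
Proof.
exists (1 / 20)%R; split; first by lra.
(* One threshold serves every [k], because the adversary uses only identifiers up to [m * m]. *)
move=> k Hk; exists (Z.to_nat (up (exp 32))) => m T A Hm Hsol.
apply: Rnot_lt_le => HT.
have Hexp : (exp 32 <= INR (m * m))%R.
  have [Hup _] := archimed (exp 32).
  have : (IZR (up (exp 32)) <= INR (m * m))%R.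
    by rewrite INR_IZR_INZ; apply: IZR_le; lia.
  by lra.
apply: locality_obstruction (small_locality Hexp HT) _ Hsol.
have Hmm : 0 < m * m.
  by apply/ltP; apply: INR_lt; have := exp_pos 32; rewrite /=; lra.
case: k Hk => // k _; rewrite Nat.pow_succ_r'.
have : (m * m) ^ k <> 0 by apply: Nat.pow_nonzero; lia.
by move=> H; apply: leq_pmulr; lia.
Qed.
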